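(* For every regular language $L$ over a finite alphabet $\Sigma$, the dynamic membership problem $\mathrm{Member}(L)$ is in $\mathrm{UDyn}\Sigma_2$, i.e., it can be maintained by a dynamic program that uses only auxiliary relations of arity at most $1$ and whose update formulas are all $\Sigma_2$-formulas (prenex formulas of the form $\exists^*\forall^*$ followed by a quantifier-free part).
   Context: Dynamic descriptive complexity (Patnaik–Immerman). A word $w=w_1\cdots w_n$ with each $w_i\in\Sigma\cup\{\epsilon\}$ is encoded as the structure with domain $\{1,\dots,n\}$, a unary relation $W_\sigma$ for each $\sigma\in\Sigma$ (the positions carrying $\sigma$; a position in no $W_\sigma$ carries $\epsilon$) and the linear order $\le$. The word represented is the concatenation of the non-$\epsilon$ symbols. Changes are $\mathrm{set}_\sigma(i)$ for $\sigma\in\Sigma\cup\{\epsilon\}$, setting position $i$ to $\sigma$. A dynamic program stores auxiliary relations over a relational schema; for each auxiliary relation symbol $R$ and each $\sigma$ it has an update formula $\varphi^R_\sigma(\bar x;y)$ over the input and auxiliary relations; after a change $\mathrm{set}_\sigma(i)$, the new $R$ consists of all tuples $\bar a$ such that $\varphi^R_\sigma(\bar a;i)$ holds in the structure formed by the changed word and the old auxiliary relations. The initial word is $\epsilon^n$ and the initial auxiliary relations are defined by a first-order formula. The program maintains $\mathrm{Member}(L)$ if a distinguished $0$-ary auxiliary relation is true exactly when the current word is in $L$, after every finite sequence of changes. For a class $\mathcal C$ of formulas, $\mathrm{UDyn}\mathcal C$ is the class of problems maintainable by such programs with all auxiliary relations of arity $\le 1$ and all update formulas in $\mathcal C$ (formulas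 in prenex normal form). *)

(* Defs.v *)
From HB Require Import structures.
From mathcomp Require Import all_boot.

Set Implicit Arguments.
Unset Strict Implicit.
Unset Printing Implicit Defensive.

Definition language (Sigma : finType) := seq Sigma -> Prop.

(* Deterministic finite automata. *)
Definition regular (Sigma : finType) (L : language Sigma) : Prop :=
  exists (Q : finType) (q0 : Q) (delta : Q -> Sigma -> Q) (F : {set Q}),
    forall u : seq Sigma, foldl delta q0 u \in F <-> L u.

(* Position i carries the symbol s if [w i = Some s], and epsilon if
   [w i = None]; the domain {1, ..., n} is shifted to 'I_n. *)
Definition word (Sigma : finType) (n : nat) := {ffun 'I_n -> option Sigma}.

Definition represented (Sigma : finType) n (w : word Sigma n) : seq Sigma :=
  pmap w (enum 'I_n).

Definition set_symbol (Sigma : finType) n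
    (w : word Sigma n) (s : option Sigma) (i : 'I_n) : word Sigma n :=
  [ffun j => if j == i then s else w j].

Record schema := Schema { symbol : finType; arity : symbol -> nat }.

Definition empty_schema : schema := Schema (of_void nat).

Definition relations (S : schema) (n : nat) :=
  forall R : symbol S, {set (arity R).-tuple 'I_n}.

Definition no_relations n : relations empty_schema n :=
  fun R : void => match R with end.

(* First-order formulas over the input relations W_s, <= and the relations of
   S. Variables are well-scoped de Bruijn indices: in [formula Sigma S k] the
   free variables are 0, ..., k-1, and a quantifier binds index 0 of its
   body and shifts the others by one. *)
Inductive formula (Sigma : finType) (S : schema) (k : nat) : Type :=
| FTrue
| FEq (x y : 'I_k)
| FLe (x y : 'I_k)
| FSym (s : Sigma) (x : 'I_k)
| FRel (R : symbol S) (xs : (arity R).-tuple 'I_k)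
| FNot (phi : formula Sigma S k)
| FAnd (phi psi : formula Sigma S k)
| FOr (phi psi : formula Sigma S k)
| FExists (phi : formula Sigma S k.+1)
| FForall (phi : formula Sigma S k.+1).

Fixpoint holds (Sigma : finType) (S : schema) n (w : word Sigma n)
    (A : relations S n) k (phi : formula Sigma S k) :
    k.-tuple 'I_n -> bool :=
  match phi with
  | FTrue => fun=> true
  | FEq x y => fun e => tnth e x == tnth e y
  | FLe x y => fun e => tnth e x <= tnth e y
  | FSym s x => fun e => w (tnth e x) == Some s
  | FRel R xs => fun e => map_tuple (tnth e) xs \in A R
  | FNot psi => fun e => ~~ holds w A psi e
  | FAnd psi1 psi2 => fun e => holds w A psi1 e && holds w A psi2 e
  | FOr psi1 psi2 => fun e => holds w A psi1 e || holds w A psi2 e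
  | FExists psi => fun e => [exists d, holds w A psi (cons_tuple d e)]
  | FForall psi => fun e => [forall d, holds w A psi (cons_tuple d e)]
  end.

Fixpoint quantifier_free (Sigma : finType) (S : schema) k
    (phi : formula Sigma S k) : bool :=
  match phi with
  | FNot psi => quantifier_free psi
  | FAnd psi1 psi2 | FOr psi1 psi2 =>
      quantifier_free psi1 && quantifier_free psi2
  | FExists _ | FForall _ => false
  | _ => true
  end.

Fixpoint Pi1 (Sigma : finType) (S : schema) k
    (phi : formula Sigma S k) : bool :=
  if phi is FForall psi then Pi1 psi else quantifier_free phi.

Fixpoint Sigma2 (Sigma : finType) (S : schema) k
    (phi : formula Sigma S k) : bool :=
  if phi is FExists psi then Sigma2 psi else Pi1 phi.

(* In the update formula of R, the variables 0, ..., arity R - 1 stand for the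
   tuple of R, and the last variable, arity R, for the changed position. *)
Record program (Sigma : finType) := Program {
  aux : schema;
  init : forall R : symbol aux, formula Sigma empty_schema (arity R);
  update : forall (R : symbol aux) (s : option Sigma),
    formula Sigma aux (arity R).+1;
  query : symbol aux;
  query_arity : arity query = 0
}.

Record state (Sigma : finType) (P : program Sigma) (n : nat) := State {
  current : word Sigma n;
  stored : relations (aux P) n
}.

Definition initial (Sigma : finType) (P : program Sigma) n : state P n :=
  let w : word Sigma n := [ffun=> None] in
  State w (fun R => [set a | holds w (@no_relations n) (init R) a]).

(* The update formulas read the changed word and the old relations. *)
Definition step (Sigma : finType) (P : program Sigma) n
    (st : state P n) (c : option Sigma * 'I_n) : state P n :=
  let w := set_symbol (current st) c.1 c.2 in
  State w (fun R =>
    [set a | holds w (stored st) (update R c.1) (rcons_tuple a c.2)]).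

Definition answer (Sigma : finType) (P : program Sigma) n
    (st : state P n) : bool :=
  tcast (esym (query_arity P)) [tuple] \in stored st (query P).

Definition maintains_member (Sigma : finType) (P : program Sigma)
    (L : language Sigma) : Prop :=
  forall n (cs : seq (option Sigma * 'I_n)),
    let st := foldl (@step Sigma P n) (initial P n) cs in
    answer st <-> L (represented (current st)).

Definition UDyn (Sigma : finType)
    (C : forall (S : schema) (k : nat), formula Sigma S k -> bool)
    (L : language Sigma) : Prop :=
  exists P : program Sigma,
    [/\ forall R : symbol (aux P), arity R <= 1,
        forall (R : symbol (aux P)) (s : option Sigma),
          C (aux P) (arity R).+1 (update R s)
      & maintains_member P L].

(* Main.v *)
(* Fix a DFA with state set Q and a ranking of Q. Give every gap m between
   consecutive positions a permutation pi_m of Q (the colouring of the states at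
   that gap), pi_0 = 1, such that reading a letter never increases the colour
   rank: rank (pi_(m+1) (delta q)) <= rank (pi_m q). Position y stores the pair
   (pi_y, pi_(y+1)), hence unary relations suffice.

   After a change at position i the colouring is repaired as pi_m * t_m: t_m = 1
   before i; at i a permutation t restores the condition; to the right of i the
   old colouring is regressive, so t is kept as long as possible and, when it
   fails, it can be replaced by one with larger weight
   \sum_q rank q * rank (t q). So t_m changes only boundedly often along the
   word. The old colour of the current state also changes boundedly often, since
   its rank never increases except possibly at i. Both are thus read off a
   deterministic left-to-right run with boundedly many state changes, and such a
   run is described by guessing the positions of the changes (exists) and
   checking that nothing changes elsewhere (forall). *)

Require Import Defs.
From mathcomp Require Import all_boot.
From mathcomp Require Import fingroup perm zify.

Set Implicit Arguments.
Unset Strict Implicit.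
Unset Printing Implicit Defensive.

(** * Runs along the positions and runs that skip some of them *)

Section SparseRuns.

Variables (X : eqType) (n : nat) (f : X -> 'I_n -> X) (s0 : X).

Definition below (m : nat) : seq 'I_n := [seq y : 'I_n <- enum 'I_n | y < m].

Definition run_before (m : nat) : X := foldl f s0 (below m).

Lemma sorted_enum_ord : sorted (relpre val ltn) (enum 'I_n).
Proof. by rewrite -sorted_map val_enum_ord iota_ltn_sorted. Qed.

Lemma relpre_ltn_trans : transitive (relpre (val : 'I_n -> nat) ltn).
Proof. by move=> y x z; apply: ltn_trans. Qed.

Lemma sorted_filter_enum (a : pred 'I_n) :
  sorted (relpre val ltn) (filter a (enum 'I_n)).
Proof. exact: (sorted_filter relpre_ltn_trans a sorted_enum_ord). Qed.

Lemma sorted_ltn_enum (zs : seq 'I_n) :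
  sorted (relpre val ltn) zs -> zs = [seq z : 'I_n <- enum 'I_n | z \in zs].
Proof.
move=> zs_sorted; apply: (irr_sorted_eq relpre_ltn_trans) => //.
- by move=> z; apply: ltnn.
- exact: sorted_filter_enum.
by move=> z; rewrite mem_filter mem_enum andbT.
Qed.

Lemma belowS (y : 'I_n) : below y.+1 = rcons (below y) y.
Proof.
apply: (irr_sorted_eq relpre_ltn_trans).
- by move=> z; apply: ltnn.
- exact: sorted_filter_enum.
- rewrite -cats1 sorted_pairwise; last exact: relpre_ltn_trans.
  rewrite pairwise_cat /= allrel1r andbT.
  rewrite -sorted_pairwise; last exact: relpre_ltn_trans.
  rewrite sorted_filter_enum andbT.
  by apply/allP => z; rewrite mem_filter => /andP[].
move=> z; rewrite mem_filter mem_enum mem_rcons inE mem_filter mem_enum !andbT.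
by rewrite ltnS leq_eqVlt.
Qed.

Lemma below_filter (m p : nat) :
  m <= p -> [seq y : 'I_n <- below p | y < m] = below m.
Proof.
move=> le_mp; rewrite /below -filter_predI; apply: eq_filter => y /=.
by case: ltnP => // /leq_trans ->.
Qed.

Lemma below_all : below n = enum 'I_n.
Proof. by apply/all_filterP/allP => y _; apply: ltn_ord. Qed.

Lemma below0 : below 0 = [::].
Proof. by rewrite /below (eq_filter (a2 := pred0)) ?filter_pred0. Qed.

Lemma run_before0 : run_before 0 = s0.
Proof. by rewrite /run_before below0. Qed.

Lemma run_beforeS (y : 'I_n) : run_before y.+1 = f (run_before y) y.
Proof. by rewrite /run_before belowS foldl_rcons. Qed.

(** By induction the abridged and the full run agree up to [y], so a skipped position that is
    stationary for either one is stationary for both. Soundness of certificates supplies the first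
    alternative, completeness the second. *)
Lemma skip_run (P : pred 'I_n) (p : nat) :
    p <= n ->
    let s m := foldl f s0 (filter P (below m)) in
    (forall y : 'I_n, y < p ->
       [|| P y, f (s y) y == s y | f (run_before y) y == run_before y]) ->
  forall m, m <= p -> s m = run_before m.
Proof.
move=> le_pn s skip; elim=> [|m IHm] lt_mp.
  by rewrite /s /run_before below0.
have lt_mn := leq_trans lt_mp le_pn; set y := Ordinal lt_mn.
have /= eq_y := IHm (ltnW lt_mp).
have := skip y lt_mp; rewrite /= -eq_y orbb.
rewrite -[m.+1]/(val y).+1 run_beforeS -eq_y /s belowS filter_rcons.
by case: (P y) => /= [_ | /eqP//]; rewrite foldl_rcons.
Qed.

End SparseRuns.

(** * Certificates for runs with few state changes *)

Definition visited (T : Type) (lt : rel T) (zs : seq T) (y : T) : seq T :=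
  [seq z <- zs | lt z y].

(* Here zs lists the positions below x where the run changes its state; entries
   that are not below x are padding. T is abstract so that the check can be
   carried out on variables as well as on positions. *)
Definition certifies (X : eqType) (T : Type) (lt : rel T) (f : X -> T -> X)
    (s0 : X) (zs : seq T) (x y : T) : bool :=
  sorted lt (visited lt zs x) &&
  (lt y x ==>
    has (fun z => ~~ lt y z && ~~ lt z y) zs
    || (f (foldl f s0 (visited lt zs y)) y == foldl f s0 (visited lt zs y))).

Lemma visited_map (T U : Type) (h : T -> U) (ltT : rel T) (ltU : rel U) :
    (forall x y, ltT x y = ltU (h x) (h y)) ->
  forall zs y, visited ltU (map h zs) (h y) = map h (visited ltT zs y).
Proof.
by move=> hlt zs y; rewrite /visited filter_map; congr map; apply: eq_filter.
Qed.

Lemma foldl_comp (X T U : Type) (h : T -> U) (fT : X -> T -> X)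
    (fU : X -> U -> X) :
    (forall s x, fT s x = fU s (h x)) ->
  forall s zs, foldl fU s (map h zs) = foldl fT s zs.
Proof. by move=> hf s zs; elim: zs s => //= z zs IHzs s; rewrite IHzs hf. Qed.

Lemma certifies_map (X : eqType) (T U : Type) (h : T -> U) (ltT : rel T)
    (ltU : rel U) (fT : X -> T -> X) (fU : X -> U -> X) :
    (forall x y, ltT x y = ltU (h x) (h y)) ->
    (forall s x, fT s x = fU s (h x)) ->
  forall s0 zs x y,
    certifies ltU fU s0 (map h zs) (h x) (h y) = certifies ltT fT s0 zs x y.
Proof.
move=> hlt hf s0 zs x y; rewrite /certifies !(visited_map hlt) sorted_map.
rewrite (eq_sorted (e' := ltT)); last by move=> ? ?; rewrite hlt.
rewrite has_map !(foldl_comp hf) -hf -hlt.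
by congr (_ && (_ ==> _ || _)); apply: eq_has => z /=; rewrite !hlt.
Qed.

Notation ltn_ord_rel := (relpre val ltn).

Section Certificates.

Variables (X : eqType) (n : nat) (f : X -> 'I_n -> X) (s0 : X).

Lemma certifies_sound (zs : seq 'I_n) (x : 'I_n) :
    (forall y, certifies ltn_ord_rel f s0 zs x y) ->
  foldl f s0 (visited ltn_ord_rel zs x) = run_before f s0 x.
Proof.
move=> cert; set zx := visited _ zs x.
have zx_sorted : sorted ltn_ord_rel zx by have /andP[] := cert x.
pose P : pred 'I_n := mem zx.
have visitedE m : m <= x -> [seq z : 'I_n <- zs | z < m] = filter P (below n m).
  move=> le_mx; transitivity [seq z : 'I_n <- zx | z < m].
    rewrite -filter_predI; apply: eq_filter => z /=.
    by case: ltnP => //= /leq_trans ->.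
  rewrite [zx](sorted_ltn_enum zx_sorted) /below -!filter_predI.
  by apply: eq_filter => z /=; rewrite [P z && _]andbC.
rewrite /zx /visited [filter _ _]visitedE //.
apply: (skip_run (p := x)) => // [|y lt_yx]; first exact: ltnW.
have /andP[_] := cert y; rewrite /= lt_yx /= => /orP[/hasP[z z_zs] | ].
  rewrite -!leqNgt -eqn_leq => /eqP/val_inj eq_zy.
  by rewrite /P /= mem_filter /= -eq_zy z_zs eq_zy lt_yx.
by rewrite /visited [filter _ _]visitedE ?(ltnW lt_yx) // => ->; rewrite orbT.
Qed.

Variable mu : X -> nat.
Hypothesis f_descends : forall s y, f s y = s \/ mu (f s y) < mu s.

Definition changes (m : nat) : seq 'I_n :=
  [seq y : 'I_n <- below n m | f (run_before f s0 y) y != run_before f s0 y].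

(** Every change costs at least one unit of [mu]; the remaining budget on the left makes the
    induction go through. *)
Lemma size_changes (m : nat) :
  m <= n -> size (changes m) + mu (run_before f s0 m) <= mu s0.
Proof.
elim: m => [|m IHm] lt_mn.
  by rewrite /changes below0 run_before0.
apply: leq_trans (IHm (ltnW lt_mn)).
rewrite -[m.+1]/(val (Ordinal lt_mn)).+1 run_beforeS /changes belowS filter_rcons /=.
case: eqP => /= [-> // | neq]; rewrite size_rcons addSnnS leq_add2l.
by case: (f_descends (run_before f s0 m) (Ordinal lt_mn)).
Qed.

Lemma certifies_complete (x : 'I_n) :
  exists zs : (mu s0).-tuple 'I_n,
    forall y, certifies ltn_ord_rel f s0 zs x y.
Proof.
set K := mu s0.
have le_size : size (changes x) <= K.
  exact: leq_trans (leq_addr _ _) (size_changes (ltnW (ltn_ord x))).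
(* The padding entry [x] is not below [x], hence never visited; it gives all certificates the same
   length, independent of [n]. *)
pose zs := changes x ++ nseq (K - size (changes x)) x.
have size_zs : size zs == K by rewrite size_cat size_nseq subnKC.
have visitedE m : m <= x -> [seq z : 'I_n <- zs | z < m] = changes m.
  move=> le_mx; rewrite filter_cat filter_nseq ltnNge le_mx cats0.
  rewrite /changes -(below_filter n le_mx) -!filter_predI.
  by apply: eq_filter => z /=; rewrite [(z < m) && _]andbC.
exists (Tuple size_zs) => y; apply/andP; split.
  rewrite /visited [filter _ _]visitedE // /changes /below -filter_predI.
  exact: sorted_filter_enum.
apply/implyP => /= lt_yx; rewrite /visited [filter _ _]visitedE ?(ltnW lt_yx) //.
have -> : foldl f s0 (changes y) = run_before f s0 y.
  apply: (skip_run (p := y)) => // [|z _]; first exact: ltnW.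
  by rewrite orbA orbAC orNb.
case: eqP => [_|/eqP neq]; rewrite ?orbT // orbF; apply/hasP; exists y.
  by rewrite mem_cat mem_filter neq mem_filter mem_enum /= lt_yx.
by rewrite ltnn.
Qed.

End Certificates.

(** * Boolean functions of atoms as quantifier-free formulas *)

Section DefinableFunctions.

Variables (Sigma : finType) (S : schema).

Definition FFalse k : formula Sigma S k := FNot (FTrue _ _ _).

(** Disjunctive normal form of [P]: any decidable check on the truth values of finitely many atoms
    becomes quantifier-free without being spelled out as a formula. *)
Definition function_formula k (At : finType) (A : At -> formula Sigma S k)
    (P : pred {ffun At -> bool}) : formula Sigma S k :=
  \big[@FOr _ _ _ / FFalse k]_(v | P v)
    \big[@FAnd _ _ _ / FTrue _ _ _]_a (if v a then A a else FNot (A a)).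

Lemma function_formula_qf k (At : finType) (A : At -> formula Sigma S k) P :
  (forall a, quantifier_free (A a)) -> quantifier_free (function_formula A P).
Proof.
move=> A_qf; apply: (big_ind (fun phi => quantifier_free phi)) => //
    [phi psi /= -> -> // | v _].
apply: (big_ind (fun phi => quantifier_free phi)) => //
    [phi psi /= -> -> // | a _].
by case: (v a) => //=.
Qed.

Lemma holds_function_formula k (At : finType) (A : At -> formula Sigma S k) P n
    (w : word Sigma n) (R : relations S n) e :
  holds w R (function_formula A P) e = P [ffun a => holds w R (A a) e].
Proof.
rewrite /function_formula.
rewrite (big_morph (fun phi => holds w R phi e) (id1 := false) (op1 := orb)) //.
rewrite big_orE; set v0 := finfun _.
have literalsE (v : {ffun At -> bool}) : holds w R (\big[@FAnd _ _ _ / FTrue _ _ _]_a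
    (if v a then A a else FNot (A a))) e = (v == v0).
  rewrite (big_morph (fun phi => holds w R phi e) (id1 := true) (op1 := andb)) //.
  rewrite big_andE; apply/forallP/eqP => [eq_v | -> a].
    apply/ffunP => a; have := eq_v a; rewrite ffunE /=.
    by case: (v a) => /= [->|/negPf->].
  by rewrite /= ffunE; case: ifP => //= ->.
apply/existsP/idP => [[v /andP[Pv]] | Pv0].
  by rewrite literalsE => /eqP <-.
by exists v0; rewrite Pv0 literalsE /=.
Qed.

Fixpoint exists_many m k : formula Sigma S (m + k) -> formula Sigma S k :=
  if m is m'.+1 then fun phi => @exists_many m' k (FExists phi) else id.

Lemma exists_many_Sigma2 m k (phi : formula Sigma S (m + k)) :
  Sigma2 phi -> Sigma2 (exists_many phi).
Proof. by elim: m phi => //= m IHm phi Sphi; apply: IHm. Qed.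

Lemma quantifier_free_Pi1 k (phi : formula Sigma S k) :
  quantifier_free phi -> Pi1 phi.
Proof. by case: phi. Qed.

Lemma holds_exists_many m k (phi : formula Sigma S (m + k)) n
    (w : word Sigma n) (R : relations S n) (e : k.-tuple 'I_n) :
  reflect (exists zs : m.-tuple 'I_n, holds w R phi [tuple of zs ++ e])
    (holds w R (exists_many phi) e).
Proof.
elim: m phi => [|m IHm] phi.
  have nilE (zs : 0.-tuple 'I_n) : [tuple of zs ++ e] = e.
    by rewrite [zs]tuple0; apply: val_inj.
  apply: (iffP idP) => [phi_e | [zs]]; last by rewrite nilE.
  by exists [tuple]; rewrite nilE.
apply: (iffP (IHm _)) => [[zs /existsP[z]] | [zs]].
  move=> phi_z; exists [tuple of z :: zs]; move: phi_z.
  by congr holds; apply: val_inj.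
case/tupleP: zs => z zs phi_z; exists zs; apply/existsP; exists z.
by move: phi_z; congr holds; apply: val_inj.
Qed.

End DefinableFunctions.

(** * Permutations that repair a colouring *)

Section Ranks.

Variable Q : finType.

Definition rank (q : Q) : nat := enum_rank q.

Lemma rank_inj : injective rank.
Proof. by move=> p q /val_inj/enum_rank_inj. Qed.

Lemma rank_lt (q : Q) : rank q < #|Q|.
Proof. exact: ltn_ord. Qed.

(** In each fibre of [u] keep the [q] of least rank under [a]. On these, [u q] determines [q], so
    [u q] can be sent to [a q] by a permutation, and the other members of the fibre only have larger
    bounds. *)
Lemma regressive_perm_exists (u : Q -> Q) (a : {perm Q}) :
  exists t : {perm Q}, [forall q, rank (t (u q)) <= rank (a q)].
Proof.
pose best q := [forall q', (u q' == u q) ==> (rank (a q) <= rank (a q'))].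
have best_exists q : exists2 q', u q' = u q & best q'.
  have uq : u q == u q by [].
  case: (@arg_minnP _ q (fun q' => u q' == u q) (rank \o a) uq) => q' /eqP uq' /= min_q'.
  exists q' => //; apply/forallP => q''; apply/implyP => /eqP uq''.
  by apply: min_q'; rewrite uq'' uq'.
have best_inj q q' : best q -> best q' -> u q = u q' -> q = q'.
  move=> /forallP/(_ q')/implyP le1 /forallP/(_ q)/implyP le2 eq_u.
  by apply/(perm_inj (s := a))/rank_inj/eqP; rewrite eqn_leq le1 ?le2 ?eq_u.
pose good (t : {perm Q}) := [set q | best q & t (u q) == a q].
(* The partial injection is extended to a permutation by taking the [t] that agrees with it most
   often; a disagreement would be repaired by a transposition that spoils no agreement. *)
case: (@arg_maxnP _ (1%g : {perm Q}) xpredT (fun t => #|good t|) isT) => t _ max_t.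
suff all_good q : best q -> t (u q) = a q.
  exists t; apply/forallP => q; have [q' eq_u best_q'] := best_exists q.
  rewrite -eq_u all_good //; move: best_q' => /forallP/(_ q)/implyP -> //.
  by rewrite eq_u.
move=> best_q; apply/eqP/contraT => bad_q.
pose y := (t^-1)%g (a q); pose t' := (tperm (u q) y * t)%g.
suff : #|good t| < #|good t'| by rewrite ltnNge => /negP[]; apply: max_t.
apply: proper_card; apply/properP; split; last first.
  by exists q; rewrite !inE ?best_q ?negb_and ?bad_q //= permM tpermL permKV.
apply/subsetP => q'; rewrite !inE => /andP[best_q' /eqP good_q'].
rewrite best_q' permM tpermD ?good_q' //=.
  apply: contraNneq bad_q => eq_u.
  by rewrite eq_u good_q' (best_inj q q').
apply: contraNneq bad_q => eq_y.
have /perm_inj eq_q : a q = a q' by rewrite -good_q' -eq_y permKV.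
by rewrite [q in u q]eq_q good_q' eq_q.
Qed.

Definition regressing_perm (u : Q -> Q) (a : {perm Q}) : {perm Q} :=
  odflt 1%g [pick t : {perm Q} | [forall q, rank (t (u q)) <= rank (a q)]].

Lemma regressing_permP (u : Q -> Q) (a : {perm Q}) (q : Q) :
  rank (regressing_perm u a (u q)) <= rank (a q).
Proof.
rewrite /regressing_perm; case: pickP => [t /forallP // | no_t].
by have [t] := regressive_perm_exists u a; rewrite no_t.
Qed.

Definition weight (t : {perm Q}) : nat := \sum_q rank q * rank (t q).

(** Rearrangement inequality: undoing an inversion increases the sum of products. *)
Lemma weight_swap (t : {perm Q}) (d y : Q) :
    rank d < rank y -> rank (t y) < rank (t d) ->
  weight t < weight (tperm d y * t).
Proof.
move=> lt_dy lt_t; have neq_yd : y != d.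
  by apply: contraTneq lt_dy => ->; rewrite ltnn.
have sumE F : \sum_q F q = F d + F y + \sum_(q | (q != d) && (q != y)) F q.
  by rewrite (bigD1 d) //= (bigD1 y) //= addnA.
rewrite /weight !sumE !permM tpermL tpermR.
set rest := (X in _ < _ + X).
have -> : rest = \sum_(q | (q != d) && (q != y)) rank q * rank (t q).
  apply: eq_bigr => q /andP[neq_qd neq_qy].
  by rewrite permM tpermD // eq_sym.
rewrite ltn_add2r; move: lt_dy lt_t.
move: (rank d) (rank y) (rank (t d)) (rank (t y)) => i j k l lt_ij lt_lk.
nia.
Qed.

Section Adjust.

Variables (u : Q -> Q) (a t : {perm Q}).

(* In [lags_swap], swapping a violated pair preserves this condition and
   increases the weight, so a heaviest lagging t' has no violation. *)
Definition lags (t' : {perm Q}) : bool :=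
  [forall q, rank (u q) <= rank ((t'^-1)%g (t (a q)))].

Definition adjust : {perm Q} :=
  if [forall q, rank (t (u q)) <= rank (t (a q))] then t
  else [arg max_(t' > t | lags t') weight t'].

Hypothesis regressive : forall q, rank (u q) <= rank (a q).

Lemma lags_refl : lags t.
Proof. by apply/forallP => q; rewrite permK. Qed.

(** Let [y] be the point that [t'] sends to the allowed value [t (a q)]. Lagging and the violation
    put [u q] strictly below [y], so the two form an inversion of [t']. After the swap one preimage
    moves up, which is harmless, and the other moves down to [u q], exactly the bound required for
    [q]. *)
Lemma lags_swap (t' : {perm Q}) (q : Q) :
    lags t' -> rank (t (a q)) < rank (t' (u q)) ->
  exists2 t'' : {perm Q}, lags t'' & weight t' < weight t''.
Proof.
move=> /forallP lag lt_q; pose y := (t'^-1)%g (t (a q)).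
have t'y : t' y = t (a q) by rewrite permKV.
have lt_y : rank (u q) < rank y.
  rewrite ltn_neqAle lag andbT (inj_eq rank_inj).
  by apply: contraTneq lt_q => ->; rewrite t'y ltnn.
exists (tperm (u q) y * t')%g; last by rewrite weight_swap ?t'y.
apply/forallP => q'; rewrite invMg tpermV permM.
case: tpermP (lag q') => [-> le_q' | eq_y _ | //].
  exact: leq_trans le_q' (ltnW lt_y).
have : t (a q') = t (a q) by rewrite -t'y -eq_y permKV.
by move=> /perm_inj/perm_inj ->.
Qed.

Lemma adjust_regressive (q : Q) : rank (adjust (u q)) <= rank (t (a q)).
Proof.
rewrite /adjust; case: ifP => [/forallP // | _].
case: (arg_maxnP weight lags_refl) => t' lag max_t'.
rewrite leqNgt; apply/negP => /(lags_swap lag)[t'' lag'' ].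
by rewrite ltnNge => /negP[]; apply: max_t'.
Qed.

Lemma adjust_weight : adjust = t \/ weight t < weight adjust.
Proof.
rewrite /adjust; case: ifP => [_ | /negbT]; first by left.
rewrite negb_forall => /existsP[q]; rewrite -ltnNge => lt_q; right.
have [t'' lag lt_t''] := lags_swap lags_refl lt_q.
case: (arg_maxnP weight lags_refl) => t' _ max_t'.
exact: leq_trans lt_t'' (max_t' _ lag).
Qed.

End Adjust.

End Ranks.

(** * The tracking run and the dynamic program *)

Section Program.

Variables (Sigma Q : finType) (q0 : Q) (delta : Q -> Sigma -> Q) (F : {set Q}).

Definition advance (q : Q) (s : option Sigma) : Q :=
  if s is Some a then delta q a else q.

Lemma foldl_advance (T : Type) (w : T -> option Sigma) (q : Q) (ys : seq T) :
  foldl (fun q y => advance q (w y)) q ys = foldl delta q (pmap w ys).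
Proof. by elim: ys q => //= y ys IHys q; rewrite IHys; case: (w y). Qed.

Definition label : finType := ({perm Q} * {perm Q})%type.

Definition letter : Type := (option Sigma * label * (bool * bool))%type.

(* None stands for the identity before the changed position is reached; the
   second component is the old colour of the current state of the new run. *)
Definition tracker : eqType := (option {perm Q} * Q)%type.

Definition correction (x : tracker) : {perm Q} := odflt 1%g x.1.

(** [a] and [b] are the old colourings at the gaps before and after the position, so [a^-1] decodes
    the state from its old colour and [u] gives the old colour of its successor. *)
Definition next (x : tracker) (l : letter) : tracker :=
  let: ((s, (a, b)), (before_or_at, at_or_after)) := l in
  let u q := b (advance q s) in
  (if ~~ at_or_after then x.1
   else if before_or_at then Some (regressing_perm u a)
   else omap (adjust u a) x.1,
   u ((a^-1)%g x.2)).

Definition max_weight : nat := \max_(t : {perm Q}) weight t.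

(** Later corrections only gain weight; the extra [#|Q|] before the change pays for the possible
    rise of the colour's rank at the changed position. *)
Definition potential (x : tracker) : nat :=
  (if x.1 is Some t then max_weight - weight t else max_weight + #|Q|) + rank x.2.

(* The guard makes the bound on the number of state changes unconditional; it
   never triggers when the stored labels are correct. *)
Definition guarded_next (x : tracker) (l : letter) : tracker :=
  if potential (next x l) < potential x then next x l else x.

Lemma guarded_next_descends (x : tracker) (l : letter) :
  guarded_next x l = x \/ potential (guarded_next x l) < potential x.
Proof. by rewrite /guarded_next; case: ifP; [right | left]. Qed.

Definition start : tracker := (None, q0).

Definition new_label (x : tracker) (l : letter) : label :=
  ((l.1.2.1 * correction x)%g, (l.1.2.2 * correction (guarded_next x l))%g).

Definition accepts (x : tracker) (l : letter) : bool :=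
  ((l.1.2.2)^-1)%g (guarded_next x l).2 \in F.

Definition letter_at n (w : word Sigma n) (lab : 'I_n -> label) (i y : 'I_n) :
  letter := ((w y, lab y), ((y <= i)%N, (i <= y)%N)).

Definition track n (w : word Sigma n) (lab : 'I_n -> label) (i : 'I_n) :
    tracker -> 'I_n -> tracker :=
  fun x y => guarded_next x (letter_at w lab i y).

(** [None] is the answer bit; [Some l] holds at the positions labelled [l]. *)
Definition label_schema : schema :=
  @Schema (option label) (fun R => if R is Some _ then 1 else 0).

Notation Formula := (formula Sigma label_schema).

Definition atom m : finType := ('I_m * 'I_m + 'I_m * Sigma + 'I_m * label)%type.

Definition atom_formula m (a : atom m) : Formula m :=
  match a with
  | inl (inl (x, y)) => FLe _ _ x y
  | inl (inr (x, s)) => FSym _ s x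
  | inr (x, l) => @FRel Sigma label_schema m (Some l) [tuple x]
  end.

Definition letter_of m (v : {ffun atom m -> bool}) (i y : 'I_m) : letter :=
  (([pick s | v (inl (inr (y, s)))],
    odflt (1%g, 1%g) [pick l | v (inr (y, l))]),
   (v (inl (inl (y, i))), v (inl (inl (i, y))))).

Definition lt_of m (v : {ffun atom m -> bool}) (x y : 'I_m) : bool :=
  ~~ v (inl (inl (y, x))).

Definition represents n (R : relations label_schema n) (lab : 'I_n -> label) :=
  forall (l : label) (x : 'I_n), ([tuple x] \in R (Some l)) = (lab x == l).

Lemma letter_ofE n (w : word Sigma n) (R : relations label_schema n) lab m
    (e : m.-tuple 'I_n) (i y : 'I_m) :
    represents R lab ->
  letter_of [ffun a => holds w R (atom_formula a) e] i y
    = letter_at w lab (tnth e i) (tnth e y).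
Proof.
move=> Rlab; rewrite /letter_of /letter_at !ffunE /=; congr (_, _, _).
  rewrite (eq_pick (Q := fun s => w (tnth e y) == Some s)); last first.
    by move=> s; rewrite ffunE.
  case: pickP => [s /eqP -> // |]; case: (w _) => // s /(_ s).
  by rewrite eqxx.
rewrite (eq_pick (Q := fun l => lab (tnth e y) == l)); last first.
  move=> l; rewrite ffunE /= -Rlab.
  by rewrite (_ : map_tuple _ _ = [tuple tnth e y]) //; apply: val_inj.
by case: pickP => [l /eqP -> // | /(_ (lab (tnth e y)))]; rewrite eqxx.
Qed.

Section TrackingFormula.

Variables (last : bool) (test : tracker -> letter -> bool).

(** [K] bounds the number of state changes and depends on the automaton only. The variables are, in
    de Bruijn order, the universal [y], the [K] guessed positions, and the free [x] and [i]. *)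
Let K := potential start.
Let y_var : 'I_(K + 2).+1 := ord0.
Let z_vars : seq 'I_(K + 2).+1 :=
  [seq lift ord0 (lshift 2 j) | j <- enum 'I_K].
Let x_var : 'I_(K + 2).+1 := lift ord0 (rshift K ord0).
Let i_var : 'I_(K + 2).+1 := lift ord0 (rshift K ord_max).

(** With [last] set, [x] must also be the last position; this shares the universal variable [y] of
    the certificate check. *)
Definition tracking_matrix (v : {ffun atom (K + 2).+1 -> bool}) : bool :=
  let f x y := guarded_next x (letter_of v i_var y) in
  [&& certifies (lt_of v) f start z_vars x_var y_var,
      last ==> ~~ lt_of v x_var y_var
    & test (foldl f start (visited (lt_of v) z_vars x_var))
        (letter_of v i_var x_var)].

Definition tracking_formula : Formula 2 :=
  exists_many
    (FForall (function_formula (@atom_formula (K + 2).+1) tracking_matrix)).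

Lemma tracking_formula_Sigma2 : Sigma2 tracking_formula.
Proof.
apply: exists_many_Sigma2 => /=; apply/quantifier_free_Pi1.
by apply: function_formula_qf => - [[[x y] | [x s]] | [x l]].
Qed.

Lemma holds_tracking_formula n (w : word Sigma n)
    (R : relations label_schema n) lab (x i : 'I_n) :
    represents R lab ->
  holds w R tracking_formula [tuple x; i] =
    (last ==> [forall y : 'I_n, y <= x]) &&
    test (run_before (track w lab i) start x) (letter_at w lab i x).
Proof.
move=> Rlab.
have matrixE (zs : K.-tuple 'I_n) (y : 'I_n) :
    holds w R (function_formula (@atom_formula (K + 2).+1) tracking_matrix)
      [tuple of y :: [tuple of zs ++ [tuple x; i]]] =
    [&& certifies ltn_ord_rel (track w lab i) start zs x y,
        last ==> (y <= x)
      & test (foldl (track w lab i) start (visited ltn_ord_rel zs x))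
          (letter_at w lab i x)].
  set e := (X in holds _ _ _ X); rewrite holds_function_formula.
  set v := finfun _.
  have y_varE : tnth e y_var = y by [].
  have x_varE : tnth e x_var = x by rewrite tnthS tnth_rshift.
  have i_varE : tnth e i_var = i by rewrite tnthS tnth_rshift.
  have z_varsE : map (tnth e) z_vars = zs.
    rewrite -[RHS]map_tnth_enum -map_comp; apply: eq_map => j /=.
    by rewrite tnthS tnth_lshift.
  have ltE j k : lt_of v j k = ltn_ord_rel (tnth e j) (tnth e k).
    by rewrite /lt_of ffunE /= -ltnNge.
  pose f p j := guarded_next p (letter_of v i_var j).
  have fE p j : f p j = track w lab i p (tnth e j).
    by rewrite /f (letter_ofE _ _ _ _ Rlab) i_varE.
  rewrite /tracking_matrix -/f.
  rewrite -(certifies_map (ltU := ltn_ord_rel) (fU := track w lab i) ltE fE).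
  rewrite z_varsE x_varE y_varE.
  rewrite ltE x_varE y_varE -leqNgt (letter_ofE _ _ _ _ Rlab) i_varE x_varE.
  rewrite -(foldl_comp (fU := track w lab i) fE).
  by rewrite -(visited_map (ltU := ltn_ord_rel) ltE) z_varsE x_varE.
apply/holds_exists_many/andP => [[zs /forallP phi] | [last_x test_x]].
  have {}phi y : [&& certifies ltn_ord_rel (track w lab i) start zs x y,
      last ==> (y <= x)
    & test (foldl (track w lab i) start (visited ltn_ord_rel zs x))
        (letter_at w lab i x)].
    by rewrite -matrixE; apply: phi.
  split.
    apply/implyP => last_t; apply/forallP => y.
    by have /and3P[_ /implyP->] := phi y.
  (* The test does not depend on [y]; any instance, such as [x], yields it. *)
  rewrite -(certifies_sound (zs := zs)) => [|y]; first by have /and3P[] := phi x.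
  by have /and3P[] := phi y.
have descends s y : track w lab i s y = s \/ potential (track w lab i s y) < potential s.
  exact: guarded_next_descends.
have [zs cert] := certifies_complete start descends x.
exists zs; apply/forallP => y; apply: etrans (matrixE zs y) _.
rewrite cert (certifies_sound cert) test_x andbT.
by apply/implyP => last_t; move/implyP: last_x => /(_ last_t)/forallP.
Qed.

End TrackingFormula.

(** On the empty word no state moves, so the identity colours every gap. The answer formula guesses
    the last position and tests acceptance there. *)
Definition tracking_program : program Sigma :=
  @Program Sigma label_schema
    (fun R => match R return formula Sigma empty_schema
                   (if R is Some _ then 1 else 0) with
              | Some l => if l == (1%g, 1%g) then FTrue _ _ _ else FFalse _ _ _
              | None => if q0 \in F then FTrue _ _ _ else FFalse _ _ _
              end)
    (fun R s => match R return Formula (if R is Some _ then 1 else 0).+1 with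
              | Some l => tracking_formula false (fun x c => new_label x c == l)
              | None => FExists (tracking_formula true accepts)
              end)
    None erefl.

Definition invariant_colouring n (w : word Sigma n) (lab : 'I_n -> label)
    (pi : nat -> {perm Q}) : Prop :=
  [/\ pi 0 = 1%g,
      forall y : 'I_n, lab y = (pi y, pi y.+1)
    & forall (y : 'I_n) (q : Q),
        rank (pi y.+1 (advance q (w y))) <= rank (pi y q)].

(** * Correctness of the repair after one change *)

Section Change.

Variables (n : nat) (w w' : word Sigma n) (lab : 'I_n -> label) (i : 'I_n).
Variable pi : nat -> {perm Q}.
Hypothesis w'_eq : forall y, y != i -> w' y = w y.
Hypothesis pi_inv : invariant_colouring w lab pi.

Let tracked m := run_before (track w' lab i) start m.
Let reached m := run_before (fun q y => advance q (w' y)) q0 m.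

Lemma weight_le_max (t : {perm Q}) : weight t <= max_weight.
Proof. exact: (leq_bigmax t). Qed.

Lemma guarded_nextE (x : tracker) (l : letter) :
  next x l = x \/ potential (next x l) < potential x ->
  guarded_next x l = next x l.
Proof. by rewrite /guarded_next => -[-> | ->] //; rewrite if_same. Qed.

Definition in_phase (m : nat) (x : tracker) : Prop :=
  if m <= i then x.1 = None else exists t, x.1 = Some t.

(** Left of [i] the old colouring is regressive for the unchanged symbols; right of [i] it is too,
    and [adjust] carries the correction along; at [i] itself [regressing_perm] works for an
    arbitrary new symbol. The third clause shows that the guard is harmless. *)
Lemma next_phase (y : 'I_n) (x : tracker) :
    in_phase y x -> x.2 = pi y (reached y) ->
  let x' := next x (letter_at w' lab i y) in
  [/\ in_phase y.+1 x', x'.2 = pi y.+1 (reached y.+1),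
      x' = x \/ potential x' < potential x
    & forall q, rank (correction x' (pi y.+1 (advance q (w' y))))
                  <= rank (correction x (pi y q))].
Proof.
case: x => o c; case: pi_inv => _ labE reg; rewrite /in_phase /= => phase -> {c}.
rewrite labE permK.
have -> : advance (reached y) (w' y) = reached y.+1 by rewrite /reached run_beforeS.
set c' := pi y.+1 _; case: (ltngtP y i) phase => [lt_yi | gt_yi | _] /=.
- move=> ->; have w'y : w' y = w y by apply: w'_eq; rewrite neq_ltn lt_yi.
  split=> // [|q]; last by rewrite /correction !perm1 w'y.
  have : rank c' <= rank (pi y (reached y)) by rewrite /c' /reached run_beforeS w'y.
  rewrite leq_eqVlt (inj_eq (@rank_inj Q)) => /predU1P[-> | lt_c]; first by left.
  by right; rewrite /potential /= ltn_add2l.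
- have w'y : w' y = w y by apply: w'_eq; rewrite neq_ltn gt_yi orbT.
  have reg' q : rank (pi y.+1 (advance q (w' y))) <= rank (pi y q) by rewrite w'y.
  case=> t ->; split=> //=; first by eexists.
    have le_c : rank c' <= rank (pi y (reached y)).
      by rewrite /c' /reached run_beforeS.
    have [-> | lt_t] := adjust_weight t reg'.
      move: le_c; rewrite leq_eqVlt (inj_eq (@rank_inj Q)) => /predU1P[-> | lt_c].
        by left.
      by right; rewrite /potential /= ltn_add2l.
    (* The weight gain strictly lowers the first summand, and the colour's rank does not rise. *)
    right; rewrite /potential /= -addSn leq_add // ltn_sub2l //.
    exact: leq_trans lt_t (weight_le_max _).
  by move=> q; apply: (adjust_regressive t reg').
- move=> ->; split=> //; first by eexists.
  right; rewrite /potential /= -addnA -addnS leq_add ?leq_subr //.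
    by rewrite ltn_addr // rank_lt.
  by move=> q; rewrite /correction /= perm1; apply: regressing_permP.
Qed.

Lemma tracked_spec (m : nat) :
  m <= n -> in_phase m (tracked m) /\ (tracked m).2 = pi m (reached m).
Proof.
elim: m => [_ | m IHm lt_mn].
  by rewrite /tracked /reached !run_before0; case: pi_inv => -> _ _; rewrite perm1.
have [phase colour] := IHm (ltnW lt_mn); pose y := Ordinal lt_mn.
have [phase' colour' /guarded_nextE eq_next _] := next_phase (y := y) phase colour.
by rewrite /tracked -[m.+1]/(val y).+1 run_beforeS [track _ _ _ _ _]eq_next.
Qed.

Lemma trackedS (y : 'I_n) :
  guarded_next (tracked y) (letter_at w' lab i y) = tracked y.+1.
Proof. by rewrite /tracked run_beforeS. Qed.

Lemma new_labels_invariant :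
  invariant_colouring w'
    (fun y => new_label (tracked y) (letter_at w' lab i y))
    (fun m => pi m * correction (tracked m))%g.
Proof.
case: (pi_inv) => pi0 labE _; split=> [|y|y q].
- by rewrite /tracked run_before0 pi0 mulg1.
- by rewrite /new_label trackedS /= labE.
have [phase colour] := tracked_spec (ltnW (ltn_ord y)).
have [_ _ /guarded_nextE eq_next reg] := next_phase phase colour.
by rewrite !permM -trackedS eq_next.
Qed.

(** The tracker holds the old colour of the new run's state, so the inverse of the old colouring at
    the final gap decodes it. *)
Lemma accepts_last (y : 'I_n) :
  (forall z : 'I_n, z <= y) ->
  accepts (tracked y) (letter_at w' lab i y)
    = (foldl delta q0 (represented w') \in F).
Proof.
move=> last_y; have eq_n : y.+1 = n.
  apply/eqP; rewrite eqn_leq ltn_ord /=.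
  by case: (n) y last_y => [[] // | p y /(_ ord_max)].
rewrite /accepts trackedS /=; case: (pi_inv) => _ -> _ /=.
have [_ ->] := tracked_spec (ltn_ord y); rewrite permK /reached eq_n.
by rewrite /run_before below_all foldl_advance.
Qed.

End Change.

(** * The invariant along all change sequences *)

Definition correct n (st : state tracking_program n) : Prop :=
  (exists lab pi, represents (stored st) lab
     /\ invariant_colouring (current st) lab pi)
  /\ answer st = (foldl delta q0 (represented (current st)) \in F).

Lemma answerE n (st : state tracking_program n) :
  answer st = ([tuple] \in stored st None).
Proof. by []. Qed.

Lemma correct_initial n : correct (initial tracking_program n).
Proof.
split; last first.
  rewrite answerE inE /= /represented (eq_pmap (f2 := fun=> None)); last first.
    by move=> y; rewrite ffunE.
  rewrite (_ : pmap _ _ = [::]); last by elim: (enum _).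
  by case: ifP.
exists (fun=> (1%g, 1%g)), (fun=> 1%g); split=> [l x | ].
  by rewrite inE /= eq_sym; case: ifP.
by split=> // y q; rewrite ffunE.
Qed.

Lemma correct_step n (st : state tracking_program n) c :
  correct st -> correct (step st c).
Proof.
case: c => s i [[lab [pi [Rlab inv]]] _].
set w' := set_symbol (current st) s i.
have w'_eq y : y != i -> w' y = current st y by rewrite ffunE => /negPf->.
split.
  exists (fun y : 'I_n => new_label (run_before (track w' lab i) start y)
                     (letter_at w' lab i y)).
  eexists; split; last exact: (new_labels_invariant w'_eq inv).
  move=> l x; rewrite inE /=.
  rewrite (_ : rcons_tuple _ _ = [tuple x; i]); last exact: val_inj.
  by rewrite (holds_tracking_formula _ _ _ _ _ Rlab).
rewrite answerE inE /=.
have holdsE x : holds w' (stored st) (tracking_formula true accepts)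
    (cons_tuple x (rcons_tuple [tuple] i)) =
    [forall y : 'I_n, y <= x] &&
    (foldl delta q0 (represented w') \in F).
  rewrite (_ : cons_tuple _ _ = [tuple x; i]); last exact: val_inj.
  rewrite (holds_tracking_formula _ _ _ _ _ Rlab) /=.
  case: forallP => //= last_x; exact: (accepts_last w'_eq inv last_x).
apply/existsP/idP => [[x] | in_F].
  by rewrite holdsE => /andP[].
(* The changed position [i] shows that the domain is nonempty, so a last position exists. *)
have lt_n : n.-1 < n by rewrite prednK // (leq_ltn_trans _ (ltn_ord i)).
exists (Ordinal lt_n); rewrite holdsE in_F andbT; apply/forallP => y /=.
by rewrite -ltnS prednK // (leq_ltn_trans _ (ltn_ord i)).
Qed.

Lemma tracking_program_maintains (L : language Sigma) :
  (forall u, foldl delta q0 u \in F <-> L u) ->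
  maintains_member tracking_program L.
Proof.
move=> recL n cs /=; rewrite -recL.
suff [_ ->] : correct (foldl (@step Sigma tracking_program n)
                         (initial tracking_program n) cs) by [].
elim/last_ind: cs => [|cs c IHcs]; first exact: correct_initial.
by rewrite foldl_rcons; apply: correct_step.
Qed.

End Program.

Theorem theorem1 (Sigma : finType) (L : language Sigma) (hL : regular L) :
  UDyn (@Sigma2 Sigma) L.
Proof.
case: hL => Q [q0 [delta [F recL]]].
exists (tracking_program q0 delta F); split.
- by case.
- by case=> [l | ] s /=; apply: tracking_formula_Sigma2.
- exact: tracking_program_maintains.
Qed.
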